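(* Let $D$ be an oriented virtual knot diagram. Denote by $D^*$ its mirror image and by $D^-$ its reverse. Then for any $n\in\mathbb{N}$ we have $$L^n_{D^*}(t,\ell)=-L^n_D(t^{-1},\ell)\qquad\text{and}\qquad L^n_{D^-}(t,\ell)=L^n_D(t^{-1},\ell).$$
   Context: $\mathbb{N}$ denotes the positive integers. A virtual knot diagram is a one-component planar knot diagram whose double points are either classical crossings (with over/under information) or virtual crossings. $C(D)$ is the set of classical crossings of $D$. The mirror image $D^*$ is obtained by switching over and under at all classical crossings of $D$; the reverse $D^-$ is obtained by reversing the orientation of $D$. Sign: draw a classical crossing $c$ with both strands oriented upward. Then $\operatorname{sgn}(c)=+1$ if the over-strand goes from bottom left to top right, and $\operatorname{sgn}(c)=-1$ if the over-strand goes from bottom right to top left. Index: an arc is an edge of $D$ between two consecutive classical crossings along the orientation. Label all arcs by integers so that labels are unchanged at virtual crossings and, at each classical crossing drawn with both strands oriented upward (whatever its sign), if the incoming arc on the left (bottom left) has label $a$ and the incoming arc on the right (bottom right) has label $b$, then the outgoing arc at top left has label $b+1$ and the outgoing arc at top right has label $a-1$. Such a labeling always exists: for example, label an arc $\alpha$ by $\lambda(\alpha)=\sum_{c\in O(\alpha)}\operatorname{sgn}(c)$, where $O(\alpha)$ is the set of classical crossings first met as overcrossings when traveling along the orientation starting from $\alpha$. Then $\operatorname{Ind}(c)=\operatorname{sgn}(c)(a-b-1)$. Dwrithe: for $n\in\mathbb{Z}\setminus\{0\}$, the $n$-th writhe is $J_n(D)=\sum_{c\in C(D),\,\operatorname{Ind}(c)=n}\operatorname{sgn}(c)$.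 For $n\in\mathbb{N}$ the $n$-th dwrithe is $\nabla J_n(D)=J_n(D)-J_{-n}(D)$. Smoothing against orientation: for $c\in C(D)$, $D_c$ is the oriented virtual knot diagram obtained by deleting $c$ and reconnecting so that (with both strands at $c$ oriented upward) the two top ends are joined to each other and the two bottom ends are joined to each other. The result is a one-component diagram, oriented as follows: the path of $D$ that leaves $c$ along the over-strand and returns to $c$ along the under-strand keeps its orientation, and the path that leaves $c$ along the under-strand and returns along the over-strand has its orientation reversed. $L$-polynomial: for $n\in\mathbb{N}$, $L^n_D(t,\ell)=\sum_{c\in C(D)}\operatorname{sgn}(c)\left(t^{\operatorname{Ind}(c)}\ell^{|\nabla J_n(D_c)|}-\ell^{|\nabla J_n(D)|}\right)$. *)

(* Defs.v *)
From mathcomp Require Import all_boot all_order all_algebra.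
From mathcomp Require Import finmap.
From mathcomp.multinomials Require Import monalg.

Set Implicit Arguments.
Unset Strict Implicit.
Unset Printing Implicit Defensive.

Import GRing.Theory.
Local Open Scope ring_scope.

(* A one-component planar diagram, up to orientation-preserving homeomorphism
   of the sphere, is recorded by the order in which its double points are met.
   Draw a double point x with both strands oriented upward: [(x, true)] is the
   passage through x along the strand from bottom left to top right, and
   [(x, false)] the passage along the strand from bottom right to top left.
   [word] lists, from an arbitrary base point and along the orientation, the
   passages through all the double points, the virtual ones included.  The
   labels of T that do not occur in [word] are not double points.  [over x] is
   the strand of x that passes over; it is irrelevant when x is virtual. *)
Record diagram (T : finType) := Diagram {
  word : seq (T * bool);
  classical : pred T;
  over : T -> bool
}.

Section Diagram.
Variables (T : finType) (D : diagram T).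

Definition well_formed : bool :=
  uniq (word D) && all (fun v => (v.1, ~~ v.2) \in word D) (word D).

(* Half-edges: [(v, false)] and [(v, true)] are the half-edges by which the
   passage v enters and leaves its double point.  [ccw] is the next half-edge
   counterclockwise: bottom left, bottom right, top right, top left. *)
Definition half_edge : Type := (T * bool * bool)%type.

Definition ccw (h : half_edge) : half_edge :=
  let: (x, s, out) := h in (x, ~~ s, if s then out else ~~ out).

Definition other_end (h : half_edge) : half_edge :=
  let: (v, out) := h in
  if out then (next (word D) v, false) else (prev (word D) v, true).

Definition face_step (h : half_edge) : half_edge := ccw (other_end h).

Definition half_edges : pred half_edge := [pred h | h.1 \in word D].

(* Euler's formula V - E + F = 2 for the connected map with V double points:
   [size (word D)] is 2V and E = 2V, while F is the number of orbits of
   [face_step].  The circle without double points has no half-edges. *)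
Definition planar : bool :=
  (word D == [::]) ||
  ((fcard face_step half_edges).*2 == size (word D) + 4)%N.

Definition virtual_knot_diagram : bool := well_formed && planar.

(* C(D) *)
Definition crossings : pred T :=
  [pred x | classical D x & (x, true) \in word D].

Definition sgn (x : T) : int := if over D x then 1 else -1.

(* An edge between consecutive double points is named by the passage v it leads
   to; [next (word D) v] then names the edge by which v leaves.  Edges that
   meet at a virtual crossing belong to the same arc. *)
Definition arc_labeling (lab : T * bool -> int) : Prop :=
  forall v, v \in word D ->
    lab (next (word D) v) =
      if classical D v.1 then (if v.2 then lab v - 1 else lab v + 1)
      else lab v.

Definition over_first (v : T * bool) (x : T) : bool :=
  let s := rot (index v (word D)) (word D) in
  (index (x, over D x) s < index (x, ~~ over D x) s)%N.

Definition arc_label (v : T * bool) : int :=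
  \sum_(x in crossings | over_first v x) sgn x.

Definition index_of (lab : T * bool -> int) (x : T) : int :=
  sgn x * (lab (x, true) - lab (x, false) - 1).

(* By [arc_label_labeling] and [index_of_labeling] below, any arc labeling
   could be used here. *)
Definition Ind : T -> int := index_of arc_label.

Definition writhe (n : int) : int := \sum_(x in crossings | Ind x == n) sgn x.

Definition dwrithe (n : nat) : int := writhe n%:Z - writhe (- n%:Z).

Definition mirror : diagram T :=
  Diagram (word D) (classical D) (fun x => ~~ over D x).

(* Reversing both strands of a double point and turning the picture by a half
   turn leaves each of them the strand from bottom left, or from bottom right,
   that it was. *)
Definition reverse : diagram T :=
  Diagram (rev (word D)) (classical D) (over D).

(* The two paths from c to c, without their passages through c: the first
   leaves along the over-strand, the second along the under-strand. *)
Definition over_path (c : T) : seq (T * bool) :=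
  behead (arc (word D) (c, over D c) (c, ~~ over D c)).

Definition under_path (c : T) : seq (T * bool) :=
  behead (arc (word D) (c, ~~ over D c) (c, over D c)).

(* Exactly one strand of x is reversed when [under_path c] is.  Turning the
   picture of x by a quarter turn, so that both strands point upward again,
   then exchanges the strands from bottom left and from bottom right. *)
Definition half_reversed (c x : T) : bool :=
  ((x, true) \in under_path c) (+) ((x, false) \in under_path c).

Definition smooth (c : T) : diagram T :=
  Diagram
    [seq (v.1, v.2 (+) half_reversed c v.1)
      | v <- over_path c ++ rev (under_path c)]
    (classical D)
    (fun x => over D x (+) half_reversed c x).

End Diagram.

(* Laurent polynomials in Z[t, t^-1, l], as finitely supported families of
   coefficients: [<< a *g (i, j) >>] is a t^i l^j. *)
Notation laurent := {malg int[(int * nat)%type]}.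

Definition invert_t (P : laurent) : laurent :=
  \sum_(k <- msupp P) << P@_k *g (- k.1, k.2) >>.

Definition Lpoly (T : finType) (n : nat) (D : diagram T) : laurent :=
  \sum_(c in crossings D)
    (<< sgn D c *g (Ind D c, `|dwrithe (smooth D c) n|%N) >>
     - << sgn D c *g (0, `|dwrithe D n|%N) >>).

Section Theory.
Variables (T : finType) (D : diagram T).
Hypothesis wfD : well_formed D.

Lemma word_uniq : uniq (word D). Proof. by case/andP: wfD. Qed.

Lemma mem_flip x s s' : ((x, s) \in word D) = ((x, s') \in word D).
Proof.
case/andP: wfD => _ /allP flipD.
suff H r r' : (x, r) \in word D -> (x, r') \in word D.
  by apply/idP/idP; apply: H.
by case: r r' => [] [] // /flipD.
Qed.

Lemma rot_index_rot (S : eqType) i (p : seq S) x : uniq p -> x \in p ->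
  rot (index x (rot i p)) (rot i p) = rot (index x p) p.
Proof.
rewrite -{1 2 5 6}(cat_take_drop i p) /rot cat_uniq => /and3P[_ Up12 _].
rewrite !drop_cat !take_cat !index_cat mem_cat orbC.
case p2x: (x \in drop i p) => /= => [_ | p1x].
  rewrite index_mem p2x [x \in _](negbTE (hasPn Up12 _ p2x)) /= addKn.
  by rewrite ltnNge leq_addr catA.
by rewrite p1x index_mem p1x addKn ltnNge leq_addr /= catA.
Qed.

Lemma arc_label_labeling : arc_labeling D (arc_label D).
Proof.
move=> v v_w; have Uw := word_uniq.
pose i := index v (word D); set u := next _ _.
have [q def_w] : exists q, rot i (word D) = v :: q.
  by eexists; apply: rot_index.
have Uq : uniq (v :: q) by rewrite -def_w rot_uniq.
have /andP[vq Uq'] := Uq.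
have u_w : u \in word D by rewrite mem_next.
have rot_u : rot (index u (word D)) (word D) = rcons q v.
  rewrite -(rot_index_rot i Uw u_w) def_w -(rot_index_rot 1 Uq); last first.
    by rewrite -def_w mem_rot.
  have -> : u = head v q.
    rewrite /u -(next_rot i Uw) def_w /=.
    by case: (q) => [|y r] /=; rewrite eqxx.
  by rewrite rot1_cons; case: (q) => [|y r] /=; rewrite eqxx rot0.
have mem_q w : w != v -> w \in word D -> w \in q.
  by move=> ne; rewrite -(mem_rot i) def_w inE (negPf ne).
have first_ne x : x != v.1 -> x \in crossings D ->
    over_first D u x = over_first D v x.
  move=> ne /andP[_ x_w]; rewrite /over_first rot_u -/i def_w.
  have nev s : (x, s) != v by apply: contra ne => /eqP <-.
  have xq s : (x, s) \in q by rewrite mem_q // (mem_flip x s true).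
  by rewrite /= !(eq_sym v) !(negPf (nev _)) -cats1 !index_cat !xq.
have first_v : over_first D v v.1 = (v.2 == over D v.1).
  rewrite /over_first -/i def_w; case: (v) => x s /=.
  by rewrite !xpair_eqE eqxx; case: s; case: (over D x).
have flip_q : (v.1, ~~ v.2) \in q.
  apply: mem_q; first by case: (v) => x [] /=; rewrite xpair_eqE eqxx.
  by rewrite (mem_flip _ _ v.2) -surjective_pairing.
have lt_q : (index (v.1, ~~ v.2) (rcons q v) < index v (rcons q v))%N.
  rewrite -cats1 !index_cat flip_q (negPf vq) (leq_trans _ (leq_addr _ _)) //.
  by rewrite index_mem.
have first_u : over_first D u v.1 = (v.2 != over D v.1).
  rewrite /over_first rot_u; move: lt_q; set r := rcons q v; case: (v) => x s /=.
  by case: s; case: (over D x) => //= lt_q; rewrite ltnNge ltnW.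
rewrite /arc_label.
have [cl | ncl] := ifP; last first.
  apply: eq_bigl => x; case xC: (x \in crossings D) => //=.
  by rewrite first_ne //; apply: contraFN ncl => /eqP <-; case/andP: xC.
have vC : v.1 \in crossings D.
  by rewrite inE cl /= (mem_flip _ _ v.2) -surjective_pairing.
have labE w : \sum_(x in crossings D | over_first D w x) sgn D x =
    (if over_first D w v.1 then sgn D v.1 else 0) +
    \sum_(x in crossings D | x != v.1) (if over_first D w x then sgn D x else 0).
  by rewrite big_mkcondr /= (bigD1 v.1).
rewrite !labE.
rewrite first_v first_u.
rewrite (eq_bigr (fun x => if over_first D v x then sgn D x else 0)); last first.
  by move=> x /andP[xC ne]; rewrite first_ne.
rewrite /sgn; case: v.2; case: (over D v.1) => /=.
- by rewrite add0r addrAC subrr add0r.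
- by rewrite addrC add0r.
- by rewrite add0r addrC.
- by rewrite add0r addrAC addNr add0r.
Qed.

Lemma index_of_labeling lab x : arc_labeling D lab -> x \in crossings D ->
  index_of D lab x = Ind D x.
Proof.
move=> labP /andP[_ x_w].
pose f v := lab v - arc_label D v.
have f_next v : v \in word D -> f (next (word D) v) = f v.
  move=> v_w; rewrite /f labP // arc_label_labeling //.
  case: ifP => // _; case: ifP => _; rewrite opprD addrACA ?opprK.
    by rewrite addNr addr0.
  by rewrite subrr addr0.
have f_const v : v \in word D -> f v = f (x, true).
  rewrite -(fconnect_cycle (cycle_next word_uniq) x_w) => /connectP[p].
  elim: p (x, true) x_w => [|w p IHp] u u_w /= => [_ -> // | /andP[/eqP <-] pP e].
  by rewrite -(f_next u u_w); apply: IHp; rewrite ?mem_next.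
have : f (x, false) = f (x, true) by rewrite f_const // (mem_flip _ _ true).
rewrite /Ind /index_of => /eqP; rewrite subr_eq => /eqP->; congr (_ * (_ - _)).
by rewrite opprD opprB addrA (addrC (lab _)) subrK.
Qed.

Lemma virtual_knot_diagram_mirror :
  virtual_knot_diagram (mirror D) = virtual_knot_diagram D.
Proof. by []. Qed.

Lemma well_formed_reverse : well_formed (reverse D).
Proof.
case/andP: wfD => Uw flipD; rewrite /well_formed rev_uniq Uw all_rev.
by apply: sub_all flipD => v; rewrite mem_rev.
Qed.

Lemma ccw_inj : injective (@ccw T).
Proof. by move=> [[x [] []]] [[y [] []]] //= [] ->. Qed.

Lemma face_step_inj : injective (face_step D).
Proof.
apply: inj_comp ccw_inj _.
apply: (can_inj (g := other_end D)) => -[v []] /=.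
  by rewrite prev_next // word_uniq.
by rewrite next_prev // word_uniq.
Qed.

Lemma half_edges_closed : fclosed (face_step D) (half_edges D).
Proof.
have ccwE h : (ccw h \in half_edges D) = (h \in half_edges D).
  by case: h => [[x s] out]; rewrite !inE /= (mem_flip _ _ s).
move=> h _ /eqP <-; rewrite /face_step ccwE.
by case: h => v []; rewrite !inE /= ?mem_next ?mem_prev.
Qed.

Lemma well_formed_smooth c : c \in crossings D -> well_formed (smooth D c).
Proof.
move=> /andP[_ c_w]; have Uw := word_uniq.
have o_w : (c, over D c) \in word D by rewrite (mem_flip _ _ true).
have u_w : (c, ~~ over D c) \in word D by rewrite (mem_flip _ _ true).
have ne_ou : (c, over D c) != (c, ~~ over D c).
  by rewrite xpair_eqE eqxx; case: (over D c).
rewrite /well_formed /smooth /=; move: (half_reversed D c) => h.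
rewrite /over_path /under_path.
case: (rot_to_arc Uw o_w u_w ne_ou) => i p q <- <- def_w /=.
have perm_w : perm_eq (word D) [:: (c, over D c), (c, ~~ over D c) & p ++ rev q].
  rewrite -(perm_rot i) def_w perm_cons -cat1s perm_catCA /= perm_cons.
  by rewrite perm_cat2l perm_sym perm_rev.
move: Uw (perm_mem perm_w); rewrite (perm_uniq perm_w).
move: (p ++ rev q) => s; rewrite !cons_uniq => /and3P[o_s u_s Us] mem_w.
pose g (v : T * bool) := (v.1, v.2 (+) h v.1).
have gK : involutive g by case=> x r; rewrite /g /= addbK.
rewrite -/g (map_inj_uniq (inv_inj gK)) Us all_map /=.
apply/allP=> -[x r] xr_s /=; apply/mapP; exists (x, ~~ r); last first.
  by rewrite /g /= addNb.
have : (x, ~~ r) \in word D by rewrite (mem_flip _ _ r) mem_w !inE xr_s !orbT.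
rewrite mem_w !inE !xpair_eqE; case: eqP xr_s => //= -> r_s.
by move: o_s u_s; case: (r) r_s; case: (over D c) => r_s; rewrite ?inE /= ?r_s ?orbT.
Qed.

End Theory.

Lemma planar_reverse (T : finType) (D : diagram T) :
  well_formed D -> planar (reverse D) = planar D.
Proof.
move=> wfD; have Uw := word_uniq wfD; have wfR := well_formed_reverse wfD.
pose turn (h : half_edge T) : half_edge T := (h.1, ~~ h.2).
have turnK : involutive turn by case=> v out; rewrite /turn /= negbK.
rewrite /planar size_rev /= -size_eq0 size_rev size_eq0.
suff -> : fcard (face_step (reverse D)) (half_edges (reverse D)) =
          fcard (face_step D) (half_edges D) by [].
have face_turn h : face_step D (turn h) = turn (face_step (reverse D) h).
  rewrite /face_step /turn /=.
  case: h => v [] /=; rewrite ?prev_rev ?next_rev //.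
    by case: (prev _ _) => x [].
  by case: (next _ _) => x [].
rewrite (adjunction_n_comp turn (fconnect_sym (face_step_inj wfD))
          (fconnect_sym (face_step_inj wfR)) (half_edges_closed wfD)).
  by apply: eq_n_comp_r => h; rewrite !inE /= mem_rev.
apply: strict_adjunction => //.
- exact: fconnect_sym (face_step_inj wfR).
- exact: half_edges_closed.
- exact: inv_inj.
- by apply/subsetP=> h _; rewrite -(turnK h) codom_f.
- by move=> h h' _; rewrite /= face_turn (inj_eq (inv_inj turnK)).
Qed.

Lemma virtual_knot_diagram_reverse (T : finType) (D : diagram T) :
  virtual_knot_diagram D -> virtual_knot_diagram (reverse D).
Proof.
case/andP=> wfD plD.
by rewrite /virtual_knot_diagram well_formed_reverse ?planar_reverse.
Qed.

(* Main.v *)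
From HB Require Import structures.
Require Import Defs.
From mathcomp Require Import all_boot all_order all_algebra finmap.
From mathcomp.multinomials Require Import monalg.

(** An arc labeling of [D] is also one of [mirror D], because the labeling rule
    does not see which strand passes over.  As mirroring changes every sign, it
    changes every index to its opposite ([Ind_mirror]).  For the reverse, the
    opposites of the labels of [D] form an arc labeling; signs are kept, the
    incoming and outgoing arcs are exchanged, and again every index changes to
    its opposite ([Ind_reverse]).  Hence [dwrithe n] is invariant under
    mirroring and changes sign under reversal, so that its absolute value is
    invariant under both.

    Smoothing at [c] depends on the over-path and the under-path of [c].
    Mirroring exchanges them; reversal also exchanges them, and reads each
    backwards.  Therefore [smooth (reverse D) c] is [smooth D c] read from
    another base point, and [smooth (mirror D) c] is
    [mirror (reverse (smooth D c))] ([dwrithe_smooth_reverse],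
    [dwrithe_smooth_mirror]).  So the exponents of l are the same for the three
    diagrams, the exponents of t are opposite, and the signs change under
    mirroring only. *)

Set Implicit Arguments.
Unset Strict Implicit.
Unset Printing Implicit Defensive.

Import GRing.Theory.
Local Open Scope ring_scope.

Lemma mcoeff_invert_t (P : laurent) k : (invert_t P)@_k = P@_(- k.1, k.2).
Proof.
have keyE (k0 : int * nat) : ((- k0.1, k0.2) == k) = (k0 == (- k.1, k.2)).
  by case: k0 k => [i j] [i' j']; rewrite !xpair_eqE /= eqr_oppLR.
rewrite /invert_t raddf_sum /=.
under eq_bigr => k0 _ do rewrite mcoeffU keyE mulrb.
rewrite -big_mkcond /= -big_filter.
have [k_in | k_out] := boolP ((- k.1, k.2) \in msupp P); last first.
  rewrite (mcoeff_outdom k_out) big_filter big1_seq // => k0 /andP[/eqP-> k_in].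
  by rewrite k_in in k_out.
by rewrite filter_pred1_uniq ?fset_uniq // big_seq1.
Qed.

Lemma invert_t_is_zmod_morphism : zmod_morphism invert_t.
Proof.
move=> P Q; apply/malgP => k.
rewrite mcoeff_invert_t (mcoeffB _ P) (mcoeffB k (invert_t P)).
by congr (_ - _); rewrite mcoeff_invert_t.
Qed.

HB.instance Definition _ :=
  GRing.isZmodMorphism.Build laurent laurent invert_t invert_t_is_zmod_morphism.

Lemma invert_tU (a : int) (i : int) (j : nat) :
  invert_t << a *g (i, j) >> = << a *g (- i, j) >>.
Proof.
apply/malgP => -[i' j']; rewrite mcoeff_invert_t !mcoeffU /=.
by rewrite !xpair_eqE eqr_oppLR.
Qed.

Lemma behead_arc_rev (S : eqType) (s : seq S) x y :
  uniq s -> x \in s -> y \in s -> x != y ->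
  behead (arc (rev s) x y) = rev (behead (arc s y x)).
Proof.
move=> Us xs ys ne; case: (rot_to_arc Us xs ys ne) => i p q _ <- def_s /=.
have revE : rev s = rot i (rot 1 (x :: rev q ++ y :: rev p)).
  rewrite -(rotrK i (rev s)) -rev_rot def_s rev_cons rot1_cons.
  by rewrite rev_cat rev_cons cat_rcons.
have Ur : uniq (x :: rev q ++ y :: rev p).
  by rewrite -(rot_uniq 1) -(rot_uniq i) -revE rev_uniq.
rewrite revE !arc_rot ?rot_uniq ?mem_rot ?mem_head //.
by rewrite left_arc.
Qed.

Lemma well_formed_mirror (T : finType) (D : diagram T) :
  well_formed D -> well_formed (mirror D).
Proof. by []. Qed.

Lemma sgn_mirror (T : finType) (D : diagram T) x : sgn (mirror D) x = - sgn D x.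
Proof. by rewrite /sgn /=; case: (Defs.over D x); rewrite ?opprK. Qed.

Lemma sgn_reverse (T : finType) (D : diagram T) x : sgn (reverse D) x = sgn D x.
Proof. by []. Qed.

Lemma crossings_reverse (T : finType) (D : diagram T) :
  crossings (reverse D) =i crossings D.
Proof. by move=> x; rewrite !inE /= mem_rev. Qed.

Section WellFormed.
Variables (T : finType) (D : diagram T).
Hypothesis wfD : well_formed D.

Lemma Ind_mirror x : x \in crossings D -> Ind (mirror D) x = - Ind D x.
Proof.
move=> xC.
rewrite -(index_of_labeling (well_formed_mirror wfD)
            (arc_label_labeling wfD : arc_labeling (mirror D) _)) //.
by rewrite /Ind /index_of sgn_mirror mulNr.
Qed.

(** [word] names an edge by the passage it leads to: the edge that leads to [v]
    in [reverse D] is the one that leaves [v] in [D]. *)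
Lemma arc_labeling_reverse lab : arc_labeling D lab ->
  arc_labeling (reverse D) (fun v => - lab (next (word D) v)).
Proof.
move=> labP v; rewrite mem_rev => v_w /=.
rewrite next_rev ?word_uniq // next_prev ?word_uniq // labP //.
by case: (classical D v.1) => //; case: v.2; rewrite opprD ?opprK ?addrK ?subrK.
Qed.

Lemma Ind_reverse x : x \in crossings D -> Ind (reverse D) x = - Ind D x.
Proof.
move=> xC; have xCr : x \in crossings (reverse D) by rewrite crossings_reverse.
have labP := arc_label_labeling wfD.
rewrite -(index_of_labeling (well_formed_reverse wfD)
            (arc_labeling_reverse labP) xCr).
case/andP: xC => cl x_w; rewrite /Ind /index_of !labP ?(mem_flip wfD _ _ true) //=.
rewrite cl sgn_reverse -mulrN; congr (_ * _).
set a := arc_label _ _; set b := arc_label _ _.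
by rewrite !opprD !opprK !addrA addrK addrAC.
Qed.

Lemma writhe_mirror m : writhe (mirror D) m = - writhe D (- m).
Proof.
rewrite /writhe -sumrN; apply: eq_big => [x|x _]; last exact: sgn_mirror.
rewrite -[x \in crossings (mirror D)]/(x \in crossings D).
by case xC: (x \in _) => //=; rewrite Ind_mirror // eqr_oppLR.
Qed.

Lemma writhe_reverse m : writhe (reverse D) m = writhe D (- m).
Proof.
apply: eq_bigl => x; rewrite crossings_reverse.
by case xC: (x \in _) => //=; rewrite Ind_reverse // eqr_oppLR.
Qed.

Lemma dwrithe_mirror n : dwrithe (mirror D) n = dwrithe D n.
Proof. by rewrite /dwrithe !writhe_mirror !opprK addrC. Qed.

Lemma dwrithe_reverse n : dwrithe (reverse D) n = - dwrithe D n.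
Proof. by rewrite /dwrithe !writhe_reverse opprK opprB. Qed.

(** The dwrithe depends neither on the base point from which the double points
    are listed nor on how [over] is encoded as a function. *)
Lemma dwrithe_rot (D' : diagram T) i n : well_formed D' ->
  word D' = rot i (word D) -> classical D' = classical D ->
  Defs.over D' =1 Defs.over D -> dwrithe D' n = dwrithe D n.
Proof.
move=> wfD' wE clE ovE; have Uw := word_uniq wfD.
have sgnE x : sgn D' x = sgn D x by rewrite /sgn ovE.
have crE : crossings D' =i crossings D.
  by move=> x; rewrite !inE /= clE wE mem_rot.
have labP : arc_labeling D' (arc_label D).
  move=> v; rewrite wE mem_rot next_rot // clE; exact: arc_label_labeling.
have writheE m : writhe D' m = writhe D m.
  apply: eq_big => [x|x _]; last exact: sgnE.
  rewrite crE; case xC: (x \in _) => //=.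
  by rewrite -(index_of_labeling wfD' labP) ?crE // /index_of sgnE.
by rewrite /dwrithe !writheE.
Qed.

Lemma paths_mirror c : (over_path (mirror D) c = under_path D c) *
                       (under_path (mirror D) c = over_path D c).
Proof. by rewrite /over_path /under_path /= negbK. Qed.

Lemma paths_reverse c : c \in crossings D ->
  (over_path (reverse D) c = rev (under_path D c)) *
  (under_path (reverse D) c = rev (over_path D c)).
Proof.
case/andP=> _ c_w; have Uw := word_uniq wfD.
have mem_c s : (c, s) \in word D by rewrite (mem_flip wfD _ _ true).
by split; apply: behead_arc_rev; rewrite // xpair_eqE eqxx; case: Defs.over.
Qed.

(** Each double point other than [c] has its two passages on the union of the
    two paths, so the double points with exactly one passage on a path
    are the same for both paths. *)
Lemma half_reversed_over_path c x : c \in crossings D ->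
  half_reversed D c x =
    ((x, true) \in over_path D c) (+) ((x, false) \in over_path D c).
Proof.
case/andP=> _ c_w; have Uw := word_uniq wfD.
have mem_c s : (c, s) \in word D by rewrite (mem_flip wfD _ _ true).
have ne : (c, Defs.over D c) != (c, ~~ Defs.over D c).
  by rewrite xpair_eqE eqxx; case: Defs.over.
suff pathsE s : ((x, s) \in over_path D c) (+) ((x, s) \in under_path D c) =
                ((x, true) \in word D) && (x != c).
  move: (pathsE true) (pathsE false); rewrite /half_reversed => <-.
  by do 4!case: (_ \in _).
rewrite (mem_flip wfD x true s) /over_path /under_path.
case: (rot_to_arc Uw (mem_c _) (mem_c _) ne) => i p q <- <- def_w /=.
move: Uw; rewrite -(rot_uniq i) -(mem_rot i (word D)) def_w cons_uniq cat_uniq /=.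
rewrite !(mem_cat, inE, negb_or) => /andP[/and3P[op _ oq]].
case/and3P=> _ /andP[up pq] /andP[uq _]; have [-> | nexc] := eqVneq x c.
  rewrite andbF; case: s; case: (Defs.over D c) op oq up uq => /= /negPf e1;
    by move=> /negPf e2 /negPf e3 /negPf e4; rewrite ?e1 ?e2 ?e3 ?e4.
rewrite !xpair_eqE !(negPf nexc) /= andbT.
have [xq | _] := boolP (_ \in q); last by rewrite orbF addbF.
by rewrite (negPf (hasPn pq _ xq)).
Qed.

Lemma half_reversed_mirror c : c \in crossings D ->
  half_reversed (mirror D) c =1 half_reversed D c.
Proof.
by move=> cC x; rewrite half_reversed_over_path // /half_reversed !paths_mirror.
Qed.

Lemma half_reversed_reverse c : c \in crossings D ->
  half_reversed (reverse D) c =1 half_reversed D c.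
Proof.
move=> cC x.
by rewrite half_reversed_over_path // /half_reversed !paths_reverse // !mem_rev.
Qed.

End WellFormed.

Section Smoothing.
Variables (T : finType) (D : diagram T) (c : T).
Hypotheses (wfD : well_formed D) (cC : c \in crossings D).

Lemma dwrithe_smooth_mirror n :
  dwrithe (smooth (mirror D) c) n = - dwrithe (smooth D c) n.
Proof.
have wfS := well_formed_smooth wfD cC; have wfRS := well_formed_reverse wfS.
rewrite -(dwrithe_reverse wfS) -(dwrithe_mirror wfRS).
apply: (@dwrithe_rot _ _ (well_formed_mirror wfRS) _ 0) => [||//|x].
- exact: (well_formed_smooth (D := mirror D)) cC.
- rewrite rot0 /= -map_rev rev_cat revK !paths_mirror.
  by apply: eq_map => v; rewrite half_reversed_mirror.
- by rewrite /= half_reversed_mirror // addNb.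
Qed.

Lemma dwrithe_smooth_reverse n :
  dwrithe (smooth (reverse D) c) n = dwrithe (smooth D c) n.
Proof.
apply: (@dwrithe_rot _ _ (well_formed_smooth wfD cC) _ (size (over_path D c)))
  => [||//|x].
- by apply: well_formed_smooth; rewrite ?well_formed_reverse ?crossings_reverse.
- rewrite /= -map_rot rot_size_cat !paths_reverse // revK.
  by apply: eq_map => v; rewrite half_reversed_reverse.
- by rewrite /= half_reversed_reverse.
Qed.

End Smoothing.

Theorem theorem4p1 (T : finType) (D : diagram T) (n : nat)
    (vkd_D : virtual_knot_diagram D) (n_gt0 : (0 < n)%N) :
  Lpoly n (mirror D) = (- invert_t (Lpoly n D))%R /\
  Lpoly n (reverse D) = invert_t (Lpoly n D).
Proof.
have /andP[wfD _] := vkd_D.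
have invE : invert_t (Lpoly n D) = \sum_(c in crossings D)
    (<< sgn D c *g (- Ind D c, `|dwrithe (smooth D c) n|%N) >>
     - << sgn D c *g (0, `|dwrithe D n|%N) >>).
  rewrite /Lpoly raddf_sum; apply: eq_bigr => c _.
  by rewrite raddfB /= !invert_tU oppr0.
rewrite invE -sumrN; split.
  apply: eq_bigr => c cC.
  rewrite sgn_mirror dwrithe_mirror // dwrithe_smooth_mirror // abszN.
  by rewrite Ind_mirror // !monalgUN opprD.
apply: eq_big => [c | c]; first exact: crossings_reverse.
rewrite crossings_reverse => cC.
rewrite (dwrithe_smooth_reverse wfD cC) (dwrithe_reverse wfD) abszN.
by rewrite (Ind_reverse wfD cC) (sgn_reverse D).
Qed.
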